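(* Let $H_3=\langle a,b\mid[[a,b],a]=[[a,b],b]=e\rangle$ be the discrete Heisenberg group with the word length metric coming from the generating set $S=\{a,b,a^{-1},b^{-1}\}$, and let $c=[a,b]$. Let $\epsilon_a$ and $\epsilon_b$ be in $\{-1,+1\}$, and let $\Omega$ be the set of all infinite words having letters in $\{a^{\epsilon_a},b^{\epsilon_b}\}$ with both letters occurring infinitely often. Then all words in $\Omega$ are geodesic, and the corresponding geodesic paths (starting at the identity) all converge to the same Busemann point, given by $$\xi^{\epsilon_a\epsilon_b}(c^zb^ya^x):=-\epsilon_a x-\epsilon_b y\qquad(x,y,z\in\mathbb{Z}).$$
   Context: $[x,y]=x^{-1}y^{-1}xy$, so $ab=bac$ and $c$ is central; every element of $H_3$ can be written uniquely as $c^zb^ya^x$ with $x,y,z\in\mathbb{Z}$. Word metric: $d(u,v)$ is the least $n$ such that $u^{-1}v$ is a product of $n$ elements of $S$. An infinite word $u_0u_1\cdots$ with letters in $S$ is geodesic if $d(e,u_0\cdots u_{n-1})=n$ for all $n$; the corresponding path is $\gamma(n)=u_0\cdots u_{n-1}$, $n\in\mathbb{N}=\{0,1,2,\dots\}$. Horofunction boundary: for $z\in H_3$ let $\psi_z(x):=d(x,z)-d(e,z)$. The horofunction boundary is the closure of $\{\psi_z\}$ in the topology of pointwise convergence, minus $\{\psi_z\}$. A path $\gamma$ converges to $\xi$ if $\psi_{\gamma(t)}\to\xi$ pointwise. A Busemann point is a limit of a geodesic path (an isometric map $\gamma:\mathbb N\to H_3$). *)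

(* Defs.v *)
From HB Require Import structures.
From mathcomp Require Import all_boot all_order all_algebra.
From mathcomp Require Import ring.
From mathcomp Require Import boolp classical_sets reals topology normedtype.

Set Implicit Arguments.
Unset Strict Implicit.
Unset Printing Implicit Defensive.

Import GRing.Theory Num.Theory.
Import numFieldNormedType.Exports.

Local Open Scope classical_set_scope.
Local Open Scope group_scope.

(* monoid.v only has natural-number exponents *)
Definition expgz (G : groupType) (g : G) (n : int) : G :=
  match n with Posz k => g ^+ k | Negz k => g ^- k.+1 end.

Definition prodg (G : groupType) (s : seq G) : G := \big[*%g/1]_(g <- s) g.

Definition gens (G : groupType) (a b : G) : seq G := [:: a; b; a^-1; b^-1].

Definition heisenberg_relations (G : groupType) (a b : G) : Prop :=
  [~ [~ a, b], a] = 1 /\ [~ [~ a, b], b] = 1.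

(* G = < a, b | [[a,b],a] = [[a,b],b] = e >, up to isomorphism: a and b generate
   G, satisfy the relators, and every pair satisfying them in a group H is the
   image of (a, b) under a homomorphism G -> H.  Such a G exists
   (heisenberg_presentation_exists below). *)
Definition heisenberg_presentation (G : groupType) (a b : G) : Prop :=
  [/\ forall g : G, exists s : seq G, {subset s <= gens a b} /\ prodg s = g,
      heisenberg_relations a b
    & forall (H : groupType) (a' b' : H), heisenberg_relations a' b' ->
        exists f : {multiplicative G -> H}, f a = a' /\ f b = b'].

Section WordMetric.
Variables (G : groupType) (a b : G).

Definition is_prod_of (n : nat) (g : G) : Prop :=
  exists s : seq G, [/\ size s = n, {subset s <= gens a b} & prodg s = g].

(* The default value 0 of xget is never used when a and b generate G. *)
Definition word_dist (u v : G) : nat :=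
  xget 0%N [set n | is_prod_of n (u^-1 * v) /\
                    forall m, is_prod_of m (u^-1 * v) -> (n <= m)%N].

Definition word_path (w : nat -> G) (n : nat) : G :=
  \big[*%g/1]_(0 <= i < n) w i.

Definition geodesic_word (w : nat -> G) : Prop :=
  (forall n, w n \in gens a b) /\
  (forall n, word_dist 1 (word_path w n) = n).

(* `|m - n| is the distance between natural numbers *)
Definition geodesic_path (gamma : nat -> G) : Prop :=
  forall m n : nat, word_dist (gamma m) (gamma n) = `|(m%:Z - n%:Z)%R|%N.

Definition Omega (ea eb : int) : set (nat -> G) :=
  [set w | [/\ forall n, w n = expgz a ea \/ w n = expgz b eb,
               forall N, exists2 n, (N <= n)%N & w n = expgz a ea
             & forall N, exists2 n, (N <= n)%N & w n = expgz b eb]].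

Variable R : realType.

Definition psi (z : G) : {ptws G -> R} :=
  fun x => ((word_dist x z)%:R - (word_dist 1 z)%:R)%R.

Definition horofunction_boundary : set {ptws G -> R} :=
  closure (range psi) `\` range psi.

Definition converges_to (gamma : nat -> G) (xi : {ptws G -> R}) : Prop :=
  forall x : G, psi (gamma t) x @[t --> \oo] --> xi x.

Definition Busemann_point (xi : {ptws G -> R}) : Prop :=
  horofunction_boundary xi /\
  exists2 gamma : nat -> G, geodesic_path gamma & converges_to gamma xi.

End WordMetric.

(* The triple (x, y, z) stands for c^z b^y a^x; the product comes from
   a^x b^y = b^y a^x c^(x y), a consequence of a b = b a c. *)

Section ExpgzTheory.
Variable G : groupType.
Implicit Types g h : G.

Lemma expgzS g (n : int) : expgz g (n + 1)%R = expgz g n * g.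
Proof.
case: n => [n|[|n]].
- by rewrite -PoszD addn1 /= expgSr.
- have -> : (Negz 0 + 1)%R = 0%R by [].
  by rewrite /= expg1 mulVg.
have -> : (Negz n.+1 + 1)%R = Negz n by rewrite !NegzE -addn1 PoszD; ring.
by rewrite /= [in RHS]expgS invgM -mulgA mulVg mulg1.
Qed.

Lemma expgz_ind g (f : int -> G) :
  f 0%R = 1 -> (forall n, f (n + 1)%R = f n * g) -> f =1 expgz g.
Proof.
move=> f0 fS n; have fP m : f (m - 1)%R = f m * g^-1.
  by rewrite -[in RHS](subrK 1%R m) fS mulgK.
have gP m : expgz g (m - 1)%R = expgz g m * g^-1.
  by rewrite -[in RHS](subrK 1%R m) expgzS mulgK.
elim: n => [|n IH|n IH] //.
  by rewrite -addn1 PoszD fS expgzS IH.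
have -> : (- n.+1%:Z = - n%:Z - 1)%R by rewrite -addn1 PoszD opprD.
by rewrite fP gP IH.
Qed.

Lemma expgzD g (m n : int) : expgz g (m + n)%R = expgz g m * expgz g n.
Proof.
rewrite -(@expgz_ind g (fun k => (expgz g m)^-1 * expgz g (m + k)%R) _ _ n).
- by rewrite mulVKg.
- by rewrite addr0 mulVg.
- by move=> k; rewrite addrA expgzS mulgA.
Qed.

Lemma expgz1 g : expgz g 1%R = g. Proof. by rewrite /= expg1. Qed.

Lemma expgzN g (n : int) : expgz g (- n)%R = (expgz g n)^-1.
Proof. by apply: (mulgI (expgz g n)); rewrite -expgzD subrr mulgV. Qed.

Lemma expgzM g (m n : int) : expgz g (m * n)%R = expgz (expgz g m) n.
Proof.
rewrite -(@expgz_ind (expgz g m) (fun k => expgz g (m * k)%R) _ _ n) ?mulr0 // => k.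
by rewrite mulrDr mulr1 expgzD.
Qed.

Lemma commute_expgz g h n : commute g h -> commute g (expgz h n).
Proof.
by move=> gh; case: n => n /=; [apply: commuteX | apply/commuteV/commuteX].
Qed.

Lemma expgzMn g h n : commute g h -> expgz (g * h) n = expgz g n * expgz h n.
Proof.
move=> gh; rewrite -(@expgz_ind (g * h) (fun k => expgz g k * expgz h k) _ _ n) ?mulg1 //.
move=> k; rewrite !expgzS -!mulgA; congr (_ * _); rewrite !mulgA.
by congr (_ * _); apply: commute_expgz.
Qed.

Lemma conjgXz g h n : (expgz g n) ^ h = expgz (g ^ h) n.
Proof.
rewrite -(@expgz_ind (g ^ h) (fun k => expgz g k ^ h) _ _ n) ?conj1g // => k.
by rewrite expgzS conjMg.
Qed.

Lemma heisenberg_swap (a b : G) (x y : int) : heisenberg_relations a b ->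
  expgz a x * expgz b y = expgz b y * expgz a x * expgz [~ a, b] (x * y)%R.
Proof.
set c := [~ a, b] => -[ca1 cb1].
have ca : commute c a by apply/commgP; rewrite ca1.
have cb : commute c b by apply/commgP; rewrite cb1.
have ba : b ^ a = b * c^-1 by rewrite invgR commgEl mulVKg.
have ab : a ^ expgz b y = a * expgz c y.
  rewrite -[LHS](mulVKg a) -commgEl commgEr conjVg conjgXz ba expgzMn.
    rewrite invgM -mulgA mulVg mulg1; congr (_ * _).
    have -> : c^-1 = expgz c (-1)%R by rewrite expgzN expgz1.
    by rewrite -expgzM -expgzN mulN1r opprK.
  exact/commuteV/commute_sym.
have -> : expgz a x * expgz b y = expgz b y * (expgz a x ^ expgz b y).
  by rewrite conjgE mulVKg.
rewrite conjgXz ab expgzMn; last exact/commute_expgz/commute_sym.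
by rewrite -expgzM [(y * x)%R]mulrC mulgA.
Qed.
End ExpgzTheory.

Definition heis_model : Type := (int * int * int)%type.
HB.instance Definition _ := Choice.on heis_model.

Definition heis_mul (u v : heis_model) : heis_model :=
  let: (x, y, z) := u in let: (x', y', z') := v in
  ((x + x')%R, (y + y')%R, (z + z' + x * y')%R).

Definition heis_inv (u : heis_model) : heis_model :=
  let: (x, y, z) := u in ((- x)%R, (- y)%R, (x * y - z)%R).

Definition heis_one : heis_model := (0%R, 0%R, 0%R).

Fact heis_mulA : associative heis_mul.
Proof. by move=> [[x y] z] [[x' y'] z'] [[p q] r] /=; congr (_, _, _); ring. Qed.
Fact heis_mul1 : left_id heis_one heis_mul.
Proof. by move=> [[x y] z] /=; congr (_, _, _); ring. Qed.
Fact heis_1mul : right_id heis_one heis_mul.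
Proof. by move=> [[x y] z] /=; congr (_, _, _); ring. Qed.
Fact heis_mulV : left_inverse heis_one heis_inv heis_mul.
Proof. by move=> [[x y] z] /=; congr (_, _, _); ring. Qed.
Fact heis_Vmul : right_inverse heis_one heis_inv heis_mul.
Proof. by move=> [[x y] z] /=; congr (_, _, _); ring. Qed.

HB.instance Definition _ := isGroup.Build heis_model
  heis_mulA heis_mul1 heis_1mul heis_mulV heis_Vmul.

Definition heis_a : heis_model := (1%R, 0%R, 0%R).
Definition heis_b : heis_model := (0%R, 1%R, 0%R).

Lemma heis_aX n : expgz heis_a n = (n, 0%R, 0%R).
Proof.
symmetry; move: n; apply: expgz_ind => // n.
by rewrite /mul /=; congr (_, _, _); ring.
Qed.

Lemma heis_bX n : expgz heis_b n = (0%R, n, 0%R).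
Proof.
by symmetry; move: n; apply: expgz_ind.
Qed.

Lemma heis_cX n : expgz [~ heis_a, heis_b] n = (0%R, 0%R, n).
Proof.
symmetry; move: n; apply: expgz_ind => // n.
by rewrite /mul /=; congr (_, _, _); ring.
Qed.

Lemma heis_rel : heisenberg_relations heis_a heis_b.
Proof. by split. Qed.

Lemma heis_normal_form (x y z : int) :
  expgz [~ heis_a, heis_b] z * expgz heis_b y * expgz heis_a x = (x, y, z).
Proof.
by rewrite heis_aX heis_bX heis_cX /mul /=; congr (_, _, _); ring.
Qed.

Section Generation.
Variables (G : groupType) (a b : G).

Lemma prodg_cat (s t : seq G) : prodg (s ++ t) = prodg s * prodg t.
Proof. exact: big_cat. Qed.

Definition generated (g : G) : Prop :=
  exists s : seq G, {subset s <= gens a b} /\ prodg s = g.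

Lemma generated1 : generated 1.
Proof. by exists [::]; split => //; rewrite /prodg big_nil. Qed.

Lemma generated_gen g : g \in gens a b -> generated g.
Proof.
move=> gS; exists [:: g]; rewrite /prodg big_seq1; split=> // h.
by rewrite inE => /eqP ->.
Qed.

Lemma generatedM g h : generated g -> generated h -> generated (g * h).
Proof.
move=> [s [sS <-]] [t [tS <-]]; exists (s ++ t); split; last exact: prodg_cat.
by move=> k; rewrite mem_cat => /orP[/sS|/tS].
Qed.

Lemma gensV g : g \in gens a b -> g^-1 \in gens a b.
Proof.
rewrite !inE => /or4P[] /eqP ->; rewrite ?invgK eqxx ?orbT //.
Qed.

Lemma generatedV g : generated g -> generated g^-1.
Proof.
move=> [s [sS <-]]; elim: s sS => [|h s IH] sS.
  by rewrite /prodg big_nil invg1; apply: generated1.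
rewrite /prodg big_cons invgM; apply: generatedM.
  by apply: IH => k ks; apply: sS; rewrite inE ks orbT.
by apply/generated_gen/gensV/sS; rewrite mem_head.
Qed.

Lemma generated_expgz g n : generated g -> generated (expgz g n).
Proof.
move=> gg; have gX k : generated (g ^+ k).
  elim: k => [|k IH]; first by rewrite expg0; apply: generated1.
  by rewrite expgS; apply: generatedM.
by case: n => n; [apply: gX | apply/generatedV/gX].
Qed.

End Generation.

Definition heis_lift (H : groupType) (a b : H) (u : heis_model) : H :=
  expgz [~ a, b] u.2 * expgz b u.1.2 * expgz a u.1.1.

Lemma heis_liftM (H : groupType) (a b : H) : heisenberg_relations a b ->
  {morph heis_lift a b : u v / u * v}.
Proof.
move=> rel; set c := [~ a, b].
move=> [[x y] z] [[x' y'] z']; rewrite /heis_lift /= -/c.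
have [ca1 cb1] := rel.
have ca : commute c a by apply/commgP; rewrite ca1.
have cb : commute c b by apply/commgP; rewrite cb1.
have cC h m : commute c h -> commute (expgz c m) h.
  by move=> ch; apply/commute_sym/commute_expgz/commute_sym.
rewrite !expgzD -!mulgA; congr (_ * _).
have cA m n : expgz c m * expgz a n = expgz a n * expgz c m.
  exact/cC/commute_expgz.
have cB m n : expgz c m * expgz b n = expgz b n * expgz c m.
  exact/cC/commute_expgz.
have cAl m n h : expgz c m * (expgz a n * h) = expgz a n * (expgz c m * h).
  by rewrite !mulgA cA.
have cBl m n h : expgz c m * (expgz b n * h) = expgz b n * (expgz c m * h).
  by rewrite !mulgA cB.
rewrite -cAl -cBl [in RHS](mulgA (expgz a x)) (heisenberg_swap _ _ rel).
by rewrite -/c -!mulgA !cBl !cAl.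
Qed.

Lemma heis_lift_a (H : groupType) (a b : H) : heis_lift a b heis_a = a.
Proof. by rewrite /heis_lift /= !expg0 !mul1g expg1. Qed.

Lemma heis_lift_b (H : groupType) (a b : H) : heis_lift a b heis_b = b.
Proof. by rewrite /heis_lift /= !expg0 mul1g mulg1 expg1. Qed.

Lemma heisenberg_presentation_exists :
  exists (G : groupType) (a b : G), heisenberg_presentation a b.
Proof.
exists heis_model, heis_a, heis_b; split; last 1 first.
- move=> H a b rel.
  pose fm := isMultiplicative.Build _ _ (heis_lift a b) (heis_liftM rel).
  pose F : {multiplicative heis_model -> H} := HB.pack (heis_lift a b) fm.
  by exists F; split; [apply: heis_lift_a | apply: heis_lift_b].
- move=> [[x y] z]; rewrite -heis_normal_form.
  have ga : generated heis_a heis_b heis_a.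
    by apply: generated_gen; rewrite !inE eqxx ?orbT.
  have gb : generated heis_a heis_b heis_b.
    by apply: generated_gen; rewrite !inE eqxx ?orbT.
  apply: generatedM; last exact: generated_expgz.
  apply: generatedM; last exact: generated_expgz.
  apply: generated_expgz; rewrite commgEl conjgE.
  by do ?[apply: generatedM | apply: generatedV].
- exact: heis_rel.
Qed.

Lemma heisenberg_normal_form (G : groupType) (a b : G) :
  heisenberg_presentation a b ->
  forall g, exists! u : int * int * int,
    g = expgz [~ a, b] u.2 * expgz b u.1.2 * expgz a u.1.1.
Proof.
move=> [gen rel univ] g; pose f := heis_lift a b.
have fM u v : f (u * v) = f u * f v by apply: heis_liftM.
have f1 : f 1 = 1 by rewrite /f /heis_lift /= !expg0 !mulg1.
have fV u : f u^-1 = (f u)^-1.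
  by apply: (mulgI (f u)); rewrite -fM !mulgV.
have [u ->] : exists u, g = f u.
  have [s [sS <-]] := gen g; elim: s sS => [|h s IH] sS.
    by exists 1; rewrite f1 /prodg big_nil.
  have [|u e] := IH; first by move=> k ks; apply: sS; rewrite inE ks orbT.
  have [v ->] : exists v, h = f v.
    have := sS h (mem_head _ _); rewrite !inE => /or4P[] /eqP ->.
    - by exists heis_a; rewrite /f heis_lift_a.
    - by exists heis_b; rewrite /f heis_lift_b.
    - by exists heis_a^-1; rewrite fV /f heis_lift_a.
    - by exists heis_b^-1; rewrite fV /f heis_lift_b.
  by exists (v * u); rewrite fM -e /prodg big_cons.
exists u; split=> // v fuv; change (f u = f v) in fuv.
have [k [ka kb]] := univ _ _ _ heis_rel.
have kM x y : k (x * y) = k x * k y by apply: gmulfM.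
have k1 : k 1 = 1 by apply: (mulgI (k 1)); rewrite -kM !mulg1.
have kV x : k x^-1 = (k x)^-1 by apply: (mulgI (k x)); rewrite -kM !mulgV.
have kX x n : k (expgz x n) = expgz (k x) n.
  move: n; apply: expgz_ind => [|n]; first exact: k1.
  by rewrite expgzS kM.
have kf w : k (f w) = w.
  case: w => [[x y] z]; rewrite /f /heis_lift !kM !kX ka kb.
  have -> : k [~ a, b] = [~ heis_a, heis_b].
    by rewrite !commgEl !conjgE !(kM, kV) ka kb.
  exact: heis_normal_form.
by rewrite -[u]kf fuv kf.
Qed.

(* Main.v *)
Require Import Defs.
From HB Require Import structures.
From mathcomp Require Import all_boot all_order all_algebra.
From mathcomp Require Import zify ring.
From mathcomp Require Import boolp classical_sets reals topology normedtype.

Set Implicit Arguments.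
Unset Strict Implicit.
Unset Printing Implicit Defensive.

Import GRing.Theory Num.Theory.
Import numFieldNormedType.Exports.

Local Open Scope classical_set_scope.
Local Open Scope group_scope.

(** Write A = a^ea and B = b^eb.  The map h : c^z b^y a^x |-> ea x + eb y is a
    homomorphism to the integers taking the value 1 on A and B and absolute
    value 1 on every generator, so |h g| is a lower bound for the word length
    of g ([calibration_le_length]).  A product of letters A and B attains this
    bound, which makes h a calibration: every path spelled with these two
    letters is geodesic, and d(u, v) = h v - h u as soon as u^-1 v is a
    positive word, that is a product of letters A and B
    ([word_dist_positive_word]).

    Convergence therefore amounts to the following: given a group element g and
    a word w in which both letters recur, g w_0 ... w_(t-1) is a positive word
    for all large t.  In the coordinates (x, y, z) of B^y A^x [A, B]^z, the
    positive words are exactly the elements with 0 <= x, 0 <= y and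
    0 <= z <= x y, since z counts the pairs of an A standing before a B
    ([heis_positive_word] is the half that matters).  Right multiplication by A
    raises x by 1 and x y - z by y, and right multiplication by B raises y by 1
    and z by x; so all four of x, y, z and x y - z eventually become
    nonnegative, whatever g is ([heis_eventually_positive]).

    Consequently psi_(w_0 ... w_(t-1)) (g) equals t - h g - t = - h g for all
    large t.  The limit - h is not of the form psi_z, because it is unbounded
    below on the powers of A while psi_z >= - d(e, z)
    ([calibration_not_psi]).

    All four choices of signs are treated at once: A and B satisfy the
    Heisenberg relations, and the presentation provides a homomorphism to the
    concrete model which sends A and B to its standard generators
    ([heisenberg_coordinates]). *)

(** * Integer sequences and word paths *)

Lemma int_diverges (u : nat -> int) (N0 : nat) :
  (forall t, (N0 <= t)%N -> (u t <= u t.+1)%R) ->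
  (forall N, exists2 t, (N <= t)%N & (u t + 1 <= u t.+1)%R) ->
  forall M : int, exists N, forall t, (N <= t)%N -> (M <= u t)%R.
Proof.
move=> mono step M.
have le s t : (N0 <= s)%N -> (s <= t)%N -> (u s <= u t)%R.
  move=> N0s /subnK <-; elim: (t - s)%N => [|n IH]; first by rewrite add0n.
  have := mono (n + s)%N; rewrite addSn; lia.
have [N N0N MN] : exists2 N, (N0 <= N)%N & (M <= u N)%R.
  have [N N0N uN] : exists2 N, (N0 <= N)%N &
      (u N0 + Posz `|M - u N0|%N <= u N)%R.
    elim: `|M - u N0|%N => [|n [N N0N uN]]; first by exists N0 => //; lia.
    have [t Nt ut] := step N; have := le N t N0N Nt.
    exists t.+1; lia.
  by exists N => //; lia.
exists N => t Nt; have := le N t N0N Nt; lia.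
Qed.

Lemma word_pathS (G : groupType) (w : nat -> G) n :
  word_path w n.+1 = word_path w n * w n.
Proof. by rewrite /word_path big_nat_recr. Qed.

Lemma word_path_cat (G : groupType) (w : nat -> G) m n :
  word_path w (m + n) = word_path w m * prodg [seq w i | i <- iota m n].
Proof.
rewrite /word_path /prodg big_map (@big_cat_nat _ _ _ m) //= ?leq_addr //.
by rewrite /index_iota subn0 addKn.
Qed.

(** * Positive words in the concrete model *)

Lemma heis_mulr_a (u : heis_model) : u * heis_a = ((u.1.1 + 1)%R, u.1.2, u.2).
Proof. by case: u => [[x y] z]; rewrite /mul /=; congr (_, _, _); ring. Qed.

Lemma heis_mulr_b (u : heis_model) :
  u * heis_b = (u.1.1, (u.1.2 + 1)%R, (u.2 + u.1.1)%R).
Proof. by case: u => [[x y] z]; rewrite /mul /=; congr (_, _, _); ring. Qed.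

(** Words with x letters a and y letters b are lattice paths, and the central
    coordinate is the area k they cut off from an x by y rectangle; every
    area between 0 and x y occurs.  The recursion on x fills the columns of the
    rectangle one at a time, and only one of them is partially filled. *)
Lemma heis_positive_word (x y k : nat) : (k <= x * y)%N ->
  exists2 s : seq heis_model, {subset s <= [:: heis_a; heis_b]}
    & prodg s = (Posz x, Posz y, Posz k).
Proof.
have nseqX (g : heis_model) n : prodg (nseq n g) = expgz g (Posz n).
  elim: n => [|n IH]; first by rewrite /prodg big_nil.
  by rewrite /prodg /= big_cons -/(prodg _) IH expgS.
elim: x k => [|x IH] k kxy.
  exists (nseq y heis_b) => [g|].
    by rewrite mem_nseq !inE => /andP[_ ->]; rewrite orbT.
  by rewrite nseqX heis_bX; congr (_, _, _); lia.
(* A leading a stands before all y letters b, so it contributes a full y. *)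
have [yk|ky] := leqP y k.
  have [|s sS sE] := IH (k - y)%N; first by lia.
  exists (heis_a :: s) => [g|].
    by rewrite inE => /predU1P[->|/sS //]; rewrite mem_head.
  rewrite /prodg big_cons -/(prodg s) sE /mul /=; congr (_, _, _); lia.
(* Otherwise a single a, placed before the last k letters b, suffices. *)
exists (nseq (y - k) heis_b ++ heis_a :: nseq k heis_b ++ nseq x heis_a).
  move=> g; rewrite mem_cat inE mem_cat !mem_nseq !inE.
  by case: (g == heis_a); case: (g == heis_b); rewrite ?andbF ?andbT ?orbF.
rewrite prodg_cat /prodg big_cons -!/(prodg _) prodg_cat !nseqX.
by rewrite !heis_bX heis_aX /mul /=; congr (_, _, _); lia.
Qed.

(** Each of x, y, z and x y - z is eventually nondecreasing along the path and
    increases by at least 1 infinitely often: the letter a adds 1 to x and y to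
    x y - z, the letter b adds 1 to y and x to z.  The last two increments are
    positive only once x and y are, which is why those come first. *)
Lemma heis_eventually_positive (g : heis_model) (w : nat -> heis_model) :
  Omega heis_a heis_b 1 1 w ->
  exists N, forall t, (N <= t)%N -> exists2 s : seq heis_model,
    {subset s <= [:: heis_a; heis_b]} & prodg s = g * word_path w t.
Proof.
move=> [wab wa wb]; rewrite !expgz1 in wab wa wb.
pose q t := g * word_path w t.
have qa t : w t = heis_a -> q t.+1 = (((q t).1.1 + 1)%R, (q t).1.2, (q t).2).
  by move=> wt; rewrite /q word_pathS wt mulgA heis_mulr_a.
have qb t : w t = heis_b ->
    q t.+1 = ((q t).1.1, ((q t).1.2 + 1)%R, ((q t).2 + (q t).1.1)%R).
  by move=> wt; rewrite /q word_pathS wt mulgA heis_mulr_b.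
have [NX qX] : exists N, forall t, (N <= t)%N -> (1 <= (q t).1.1)%R.
  apply: (@int_diverges _ 0) => [t _|N].
    by case: (wab t) => [/qa|/qb] -> /=; lia.
  by have [t Nt /qa qt] := wa N; exists t => //; rewrite qt.
have [NY qY] : exists N, forall t, (N <= t)%N -> (1 <= (q t).1.2)%R.
  apply: (@int_diverges _ 0) => [t _|N].
    by case: (wab t) => [/qa|/qb] -> /=; lia.
  by have [t Nt /qb qt] := wb N; exists t => //; rewrite qt.
have [NK qK] : exists N, forall t, (N <= t)%N -> (0 <= (q t).2)%R.
  apply: (@int_diverges _ NX) => [t /qX|N].
    by case: (wab t) => [/qa|/qb] -> /=; lia.
  have [t Nt /qb qt] := wb (maxn N NX); exists t; first by lia.
  by have := qX t; rewrite qt /=; lia.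
have [ND qD] : exists N, forall t, (N <= t)%N ->
    (0 <= (q t).1.1 * (q t).1.2 - (q t).2)%R.
  apply: (@int_diverges (fun t => (q t).1.1 * (q t).1.2 - (q t).2)%R NY)
    => [t /qY|N].
    by case: (wab t) => [/qa|/qb] -> /=; lia.
  have [t Nt /qa qt] := wa (maxn N NY); exists t; first by lia.
  by have := qY t; rewrite qt /=; lia.
exists (maxn (maxn NX NY) (maxn NK ND)) => t; rewrite !geq_max.
move=> /andP[/andP[/qX X1 /qY Y1] /andP[/qK K0 /qD D0]].
rewrite -/(q t); move: X1 Y1 K0 D0; case: (q t) => [[[x|x] [y|y]] [k|k]] //=.
move=> _ _ _ kxy; apply: heis_positive_word; lia.
Qed.

(** * Calibrating the word metric by a homomorphism *)

Section Words.
Variables (G : groupType) (a b : G).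

Lemma word_dist_eq u v n : is_prod_of a b n (u^-1 * v) ->
  (forall m, is_prod_of a b m (u^-1 * v) -> (n <= m)%N) ->
  word_dist a b u v = n.
Proof.
move=> un minn; rewrite /word_dist; case: xgetP => [k _ [uk mink]|none].
  by apply/eqP; rewrite eqn_leq mink ?minn.
by case: (none n).
Qed.

Lemma is_prod_ofV n g : is_prod_of a b n g -> is_prod_of a b n g^-1.
Proof.
move=> [s [<- sS <-]] {n g}; elim: s sS => [|k s IH] sS.
  by exists [::]; rewrite /prodg big_nil invg1.
have [|t [tn tS tE]] := IH.
  by move=> g gs; apply: sS; rewrite inE gs orbT.
exists (rcons t k^-1); rewrite size_rcons tn; split=> // [g|].
  rewrite mem_rcons inE => /predU1P[->|/tS //].
  exact/gensV/sS/mem_head.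
by rewrite -cats1 prodg_cat tE /prodg !big_cons big_nil mulg1 invgM.
Qed.

Lemma word_dist_sym u v : word_dist a b u v = word_dist a b v u.
Proof.
have E x y n : is_prod_of a b n (x^-1 * y) -> is_prod_of a b n (y^-1 * x).
  by move=> /is_prod_ofV; rewrite invgM invgK.
rewrite /word_dist; congr (xget _ _); apply/seteqP; split=> n [xn minn];
  by split=> [|m /E]; [apply: E | apply: minn].
Qed.

Variable h : G -> int.
Hypothesis hM : forall x y, h (x * y) = (h x + h y)%R.
Hypothesis h_gens : forall s, s \in gens a b -> (`|h s| <= 1)%N.

Lemma calibration1 : h 1 = 0%R.
Proof. by apply: (addrI (h 1)); rewrite -hM mulg1 addr0. Qed.

Lemma calibrationV g : h g^-1 = (- h g)%R.
Proof. by apply: (addrI (h g)); rewrite -hM mulgV calibration1 subrr. Qed.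

Lemma calibration_expgz g n : h (expgz g n) = (n * h g)%R.
Proof.
have hX k : h (g ^+ k) = (Posz k * h g)%R.
  elim: k => [|k IH]; first by rewrite expg0 calibration1 mul0r.
  by rewrite expgS hM IH; lia.
by case: n => n /=; rewrite ?calibrationV hX ?NegzE; lia.
Qed.

Lemma calibration_le_length n g : is_prod_of a b n g -> (`|h g| <= n)%N.
Proof.
move=> [s [<- sS <-]] {g n}; elim: s sS => [|k s IH] sS.
  by rewrite /prodg big_nil calibration1.
rewrite /prodg big_cons -/(prodg s) hM /=.
have := h_gens (sS k (mem_head _ _)).
have : (`|h (prodg s)| <= size s)%N.
  by apply: IH => x xs; apply: sS; rewrite inE xs orbT.
lia.
Qed.

(** A factorization whose length meets the lower bound given by h is shortest. *)
Lemma word_dist_calibrated u v n : is_prod_of a b n (u^-1 * v) ->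
  `|h v - h u|%N = n -> word_dist a b u v = n.
Proof.
move=> uvn hn; apply: word_dist_eq => // m /calibration_le_length.
by rewrite hM calibrationV addrC hn.
Qed.

Variables A B : G.
Hypotheses (Agen : A \in gens a b) (Bgen : B \in gens a b).
Hypotheses (hA : h A = 1%R) (hB : h B = 1%R).

Lemma calibration_positive_word s :
  {subset s <= [:: A; B]} -> h (prodg s) = Posz (size s).
Proof.
elim: s => [|k s IH] sS; first by rewrite /prodg big_nil calibration1.
rewrite /prodg big_cons hM -/(prodg s) IH => [|g gs]; last first.
  by apply: sS; rewrite inE gs orbT.
have := sS k (mem_head _ _).
rewrite !inE => /orP[] /eqP ->; rewrite ?hA ?hB /=; lia.
Qed.

Lemma word_dist_positive_word u v s :
  {subset s <= [:: A; B]} -> prodg s = u^-1 * v ->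
  Posz (word_dist a b u v) = (h v - h u)%R.
Proof.
move=> sS sE; have := calibration_positive_word sS.
rewrite sE hM calibrationV addrC => hvu.
rewrite hvu (@word_dist_calibrated u v (size s)) //; last by rewrite hvu.
by exists s; split=> // g /sS; rewrite mem_seq2 => /orP[] /eqP ->.
Qed.

Section Path.
Variable w : nat -> G.
Hypothesis w_letters : forall n, w n \in [:: A; B].

Lemma letters_sub m n : {subset [seq w i | i <- iota m n] <= [:: A; B]}.
Proof. by move=> g /mapP[i _ ->]. Qed.

Lemma calibration_word_path n : h (word_path w n) = Posz n.
Proof.
have := word_path_cat w 0 n; rewrite /word_path big_nil mul1g add0n => ->.
by rewrite (calibration_positive_word (@letters_sub _ _)) size_map size_iota.
Qed.

Lemma word_path_geodesic : geodesic_path a b (word_path w).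
Proof.
move=> m n; wlog mn : m n / (m <= n)%N.
  move=> W; case: (leqP m n) => [|/ltnW] mn; first exact: W.
  by rewrite word_dist_sym W // distnC.
have E : prodg [seq w i | i <- iota m (n - m)] =
    (word_path w m)^-1 * word_path w n.
  by apply: (mulgI (word_path w m)); rewrite mulVKg -word_path_cat subnKC.
have := word_dist_positive_word (@letters_sub _ _) E.
rewrite !calibration_word_path; lia.
Qed.

Lemma word_path_dist1 n : word_dist a b 1 (word_path w n) = n.
Proof.
have := word_path_geodesic 0 n; rewrite {1}/word_path big_nil => ->; lia.
Qed.

Lemma word_path_converges (R : realType) :
  (forall g, exists N, forall t, (N <= t)%N -> exists2 s : seq G,
    {subset s <= [:: A; B]} & prodg s = g * word_path w t) ->
  converges_to a b (word_path w) (fun g => (- h g)%R%:~R%R : R).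
Proof.
move=> pos x; apply: cvg_near_cst; have [N posN] := pos x^-1.
exists N => // t /= /posN[s sS /(word_dist_positive_word sS)].
rewrite calibration_word_path /psi word_path_dist1 => xt.
rewrite !pmulrn -intrB xt; congr (_%:~R)%R; ring.
Qed.

End Path.

(** The function - h is unbounded below along the powers of A, whereas psi_z is
    bounded below by - d(e, z) because distances are nonnegative. *)
Lemma calibration_not_psi (R : realType) (z : G) :
  psi a b R z <> (fun g => (- h g)%R%:~R%R : R).
Proof.
pose n := word_dist a b 1 z.
(* The exponent d(e, z) + 1 would force a distance equal to -1. *)
move=> /(congr1 (fun f : G -> R => f (A ^+ n.+1)))/(canRL (subrK _)).
rewrite -[A ^+ _]/(expgz A (Posz n.+1)) calibration_expgz hA mulr1 -/n => dE.
have : (0 <= (word_dist a b (expgz A n.+1) z)%:R :> R)%R by rewrite ler0n.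
rewrite dE mulrNz -pmulrn -natr1 opprD addrAC.
by rewrite addNr add0r oppr_ge0 ler10.
Qed.

End Words.

(** The topology of pointwise convergence is the supremum of the topologies
    induced by the evaluations, so coordinatewise limits are limits in it. *)
Lemma converges_closure (G : groupType) (a b : G) (R : realType)
    (gamma : nat -> G) (xi : {ptws G -> R}) :
  converges_to a b gamma xi -> closure (range (psi a b R)) xi.
Proof.
move=> cv; rewrite closureEcvg.
exists ((fun t => psi a b R (gamma t)) @ \oo); first exact: fmap_proper_filter.
split; last by move=> P PP; exists 0%N => // t _; apply: PP; exists (gamma t).
apply/cvg_sup => x U [_ [[W oW <-] Wx] WU].
by apply: (filterS WU); apply: cv; apply: open_nbhs_nbhs.
Qed.

(** * Heisenberg coordinates adapted to the signs *)

Lemma heisenberg_relations_expgz (G : groupType) (a b : G) (m n : int) :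
  heisenberg_relations a b -> heisenberg_relations (expgz a m) (expgz b n).
Proof.
move=> rel; have [ca1 cb1] := rel; set c := [~ a, b] in ca1 cb1.
have cab : [~ expgz a m, expgz b n] = expgz c (m * n)%R.
  apply: (mulgI (expgz b n * expgz a m)); rewrite -heisenberg_swap //.
  by rewrite commgEl conjgE !mulgA mulgK mulgV mul1g.
rewrite /heisenberg_relations cab.
by split; apply/eqP/commgP; apply/commute_sym/commute_expgz/commute_sym;
  apply: commute_expgz; apply/commgP; rewrite ?ca1 ?cb1.
Qed.

Lemma expgz_sign (G : groupType) (g : G) (e : int) : (e = 1 \/ e = -1)%R ->
  expgz (expgz g e) e = g.
Proof.
by move=> e1; rewrite -expgzM (_ : e * e = 1)%R ?expgz1 //; case: e1 => ->.
Qed.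

Lemma morphism_expgz (G H : groupType) (f : G -> H) :
  {morph f : x y / x * y} ->
  forall g n, f (expgz g n) = expgz (f g) n.
Proof.
move=> fM g; apply: expgz_ind => [|n]; last by rewrite expgzS fM.
by apply: (mulgI (f 1)); rewrite -fM !mulg1.
Qed.

Lemma eq_morphisms (G H : groupType) (a b : G) (f f' : G -> H) :
  (forall g, generated a b g) ->
  {morph f : x y / x * y} -> {morph f' : x y / x * y} ->
  f a = f' a -> f b = f' b -> f =1 f'.
Proof.
move=> gen fM f'M fa fb g; have [s [sS <-]] := gen g.
have fX := morphism_expgz fM; have f'X := morphism_expgz f'M.
elim: s sS => [|k s IH] sS.
  by rewrite /prodg big_nil; have := fX 1 0%R; have := f'X 1 0%R => /= -> ->.
rewrite /prodg big_cons fM f'M IH => [|x xs]; last first.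
  by apply: sS; rewrite inE xs orbT.
have := fX a (-1)%R; have := fX b (-1)%R.
have := f'X a (-1)%R; have := f'X b (-1)%R.
rewrite /= !expg1 => f'b' f'a' fb' fa'; congr (_ * _).
have := sS k (mem_head _ _); rewrite !inE => /or4P[] /eqP -> //.
  by rewrite fa' f'a' fa.
by rewrite fb' f'b' fb.
Qed.

(** The presentation sends a and b to the powers of the standard generators with
    exponents ea and eb.  As ea^2 = eb^2 = 1, this sends A and B to the standard
    generators themselves, and the reconstruction of an element from its
    coordinates with respect to A and B is a left inverse because it is one on a
    and b. *)
Lemma heisenberg_coordinates (G : groupType) (a b : G) (ea eb : int) :
  heisenberg_presentation a b ->
  (ea = 1 \/ ea = -1)%R -> (eb = 1 \/ eb = -1)%R ->
  let A := expgz a ea in let B := expgz b eb in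
  exists f : {multiplicative G -> heis_model},
    [/\ f A = heis_a, f B = heis_b & cancel f (heis_lift A B)].
Proof.
move=> [gen rel univ] ea1 eb1 A B.
have [f [fa fb]] := univ _ _ _ (heisenberg_relations_expgz ea eb heis_rel).
have fM : {morph f : x y / x * y} := gmulfM.
have relAB : heisenberg_relations A B by apply: heisenberg_relations_expgz.
have lM := heis_liftM relAB.
exists f; split.
- by rewrite (morphism_expgz fM) fa expgz_sign.
- by rewrite (morphism_expgz fM) fb expgz_sign.
apply: (eq_morphisms (f := heis_lift A B \o f) (f' := id) gen) => //=.
- by move=> x y /=; rewrite fM lM.
- by rewrite fa (morphism_expgz lM) heis_lift_a expgz_sign.
- by rewrite fb (morphism_expgz lM) heis_lift_b expgz_sign.
Qed.

(** Transports [heis_eventually_positive] back to the group: a positive word for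
    the coordinates of an element lifts to one for the element itself. *)
Lemma Omega_eventually_positive (G : groupType) (A B : G)
    (f : {multiplicative G -> heis_model}) (w : nat -> G) (g : G) :
  heisenberg_relations A B ->
  f A = heis_a -> f B = heis_b -> cancel f (heis_lift A B) ->
  Omega A B 1 1 w ->
  exists N, forall t, (N <= t)%N -> exists2 s : seq G,
    {subset s <= [:: A; B]} & prodg s = g * word_path w t.
Proof.
move=> rel fA fB fK [wAB wA wB]; rewrite !expgz1 in wAB wA wB.
have lM := heis_liftM rel.
have l1 : heis_lift A B 1 = 1.
  by apply: (mulgI (heis_lift A B 1)); rewrite -lM !mulg1.
have f1 : f 1 = 1 by apply: (mulgI (f 1)); rewrite -gmulfM !mulg1.
have [|N posN] := @heis_eventually_positive (f g) (f \o w).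
  split=> n; rewrite !expgz1.
  - by case: (wAB n) => /= ->; [left | right].
  - by have [t nt wt] := wA n; exists t; rewrite //= wt.
  - by have [t nt wt] := wB n; exists t; rewrite //= wt.
exists N => t /posN[s sS sE]; exists (map (heis_lift A B) s).
  move=> _ /mapP[u /sS + ->]; rewrite !inE => /orP[] /eqP ->.
    by rewrite heis_lift_a eqxx.
  by rewrite heis_lift_b eqxx orbT.
have -> : prodg (map (heis_lift A B) s) = heis_lift A B (prodg s).
  by rewrite /prodg big_map (big_morph _ lM l1).
rewrite {}sE; have -> : word_path (f \o w) t = f (word_path w t).
  by rewrite /word_path (big_morph f gmulfM f1).
by rewrite -gmulfM fK.
Qed.

(** * Convergence to the Busemann point *)

Definition height (u : heis_model) : int := (u.1.1 + u.1.2)%R.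

Lemma heightM u v : height (u * v) = (height u + height v)%R.
Proof.
by case: u v => [[x y] z] [[x' y'] z']; rewrite /height /mul /=; ring.
Qed.

Theorem theorem5p3 (R : realType) (G : groupType) (a b : G)
    (ea eb : int) :
  heisenberg_presentation a b ->
  (ea = 1%Z \/ ea = (-1)%Z) -> (eb = 1%Z \/ eb = (-1)%Z) ->
  (forall w : nat -> G, Omega a b ea eb w -> geodesic_word a b w) /\
  exists xi : {ptws G -> R},
    [/\ Busemann_point a b xi,
        forall x y z : int,
          xi (expgz [~ a, b] z * expgz b y * expgz a x)
            = (- (ea * x) - eb * y)%R%:~R%R
      & forall w : nat -> G, Omega a b ea eb w ->
          converges_to a b (word_path w) xi].
Proof.
move=> pres ea1 eb1; have [_ rel _] := pres.
have [f [fA fB fK]] := heisenberg_coordinates pres ea1 eb1.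
set A := expgz a ea in fA fK; set B := expgz b eb in fB fK.
pose h g := height (f g).
have hM x y : h (x * y) = (h x + h y)%R by rewrite /h gmulfM heightM.
have hA : h A = 1%R by rewrite /h fA.
have hB : h B = 1%R by rewrite /h fB.
have ha : h a = ea.
  by rewrite -(expgz_sign a ea1) (calibration_expgz hM) -/A hA mulr1.
have hb : h b = eb.
  by rewrite -(expgz_sign b eb1) (calibration_expgz hM) -/B hB mulr1.
have h_gens s : s \in gens a b -> (`|h s| <= 1)%N.
  by rewrite !inE => /or4P[] /eqP ->; rewrite ?(calibrationV hM) ?ha ?hb;
    case: ea1 => eE; case: eb1 => eE'; rewrite ?eE ?eE'.
have Agen : A \in gens a b.
  by rewrite /A; case: ea1 => -> /=; rewrite expg1 !inE eqxx ?orbT.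
have Bgen : B \in gens a b.
  by rewrite /B; case: eb1 => -> /=; rewrite expg1 !inE eqxx ?orbT.
have OmegaAB w : Omega a b ea eb w -> Omega A B 1 1 w by [].
have letters w : Omega a b ea eb w -> forall n, w n \in [:: A; B].
  by move=> [wAB _ _] n; rewrite !inE; case: (wAB n) => ->; rewrite eqxx ?orbT.
have cv w : Omega a b ea eb w ->
    converges_to a b (word_path w) (fun g => (- h g)%R%:~R%R : R).
  move=> Ow; apply: (word_path_converges hM h_gens Agen Bgen) => // [|g].
    exact: letters.
  exact: (Omega_eventually_positive g (heisenberg_relations_expgz ea eb rel)
    fA fB fK (OmegaAB w Ow)).
split=> [w Ow|].
  split=> n; last first.
    exact: (word_path_dist1 hM h_gens Agen Bgen hA hB (letters w Ow)).
  by have := letters w Ow n; rewrite mem_seq2 => /orP[] /eqP ->.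
exists (fun g => (- h g)%R%:~R%R); split=> //; last first.
  move=> x y z; congr (_%:~R)%R; rewrite !hM !(calibration_expgz hM).
  by rewrite commgEl conjgE !hM !(calibrationV hM) ha hb; ring.
pose w n := if odd n then A else B.
have Ow : Omega a b ea eb w.
  split=> [n|N|N].
  - by rewrite /w; case: odd; [left | right].
  - by exists N.*2.+1; [lia | rewrite /w /= odd_double].
  - by exists N.*2; [lia | rewrite /w odd_double].
split.
  split; first exact: converges_closure (cv w Ow).
  by move=> [z _]; apply: (calibration_not_psi hM hA).
exists (word_path w); last exact: cv.
exact: (word_path_geodesic hM h_gens Agen Bgen hA hB (letters w Ow)).
Qed.
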